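(* Let $\Omega_0$ be the regular hexagon of unit area in $\mathbb{R}^2$. There exists a sequence $(\Omega_k)_{k \ge 1}$ of hexagons ($6$-gons) in $\mathbb{R}^2$ with $|\Omega_k| = 1$ for every $k$ such that $\sup_k h(\Omega_k) < \infty$ and $$\inf\{\operatorname{hd}(\partial \Omega_k, \partial \rho\Omega_0) \;:\; \rho \text{ a rigid motion of } \mathbb{R}^2\} \to \infty \quad \text{as } k \to \infty.$$
   Context: For a Borel set $\Omega \subset \mathbb{R}^2$ of finite positive measure, the Cheeger constant of $\Omega$ is $$h(\Omega) = \inf\left\{ \frac{P(E)}{|E|} \;:\; E \subseteq \Omega \text{ measurable},\ |E| > 0 \right\},$$ where $|\cdot|$ denotes Lebesgue measure (area) and $P(E)$ is the perimeter of $E$ (in the sense of sets of finite perimeter, with $P(E)=+\infty$ if $E$ does not have finite perimeter). An $N$-gon is a (not necessarily convex) polygon with $N$ sides, that is, the planar region bounded by a simple closed polygonal curve with $N$ sides. $\operatorname{hd}(\cdot,\cdot)$ denotes the Hausdorff distance between sets, and $\rho\Omega_0 = \rho(\Omega_0)$. *)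

(* Defs.v *)
From mathcomp Require Import all_boot all_order all_algebra.
From mathcomp Require Import all_classical all_reals all_analysis.

Set Implicit Arguments.
Unset Strict Implicit.
Unset Printing Implicit Defensive.

Import Order.TTheory GRing.Theory Num.Theory.
Import numFieldNormedType.Exports.

Local Open Scope classical_set_scope.
Local Open Scope ring_scope.

(* The library norm on R * R is the sup norm. It is used below only for the
   topology, derivatives and boundedness; metric notions use [euclid_dist]. *)
Notation plane R := (R * R)%type (only parsing).

(* Two-dimensional Lebesgue measure. The measurable sets are those of the
   product of the Borel sigma-algebras, i.e., the Borel sets of the plane. *)
Definition area (R : realType) :
    {measure set (measurableTypeR R * measurableTypeR R)%type -> \bar R} :=
  (@lebesgue_measure R \x @lebesgue_measure R)%E.

Definition euclid_dist (R : realType) (x y : plane R) : R :=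
  Num.sqrt ((x.1 - y.1) ^+ 2 + (x.2 - y.2) ^+ 2).

(* Continuously differentiable (continuous first partial derivatives) with
   compact support. *)
Definition C1_compact_support (R : realType) (f : plane R -> R) : Prop :=
  [/\ forall x, derivable f x (1, 0) /\ derivable f x (0, 1),
      continuous (fun x => 'D_(1, 0) f x),
      continuous (fun x => 'D_(0, 1) f x) &
      compact (closure [set x | f x != 0])].

(* De Giorgi perimeter: the supremum of the integral over E of the divergence
   of (f, g), over C^1_c vector fields (f, g) of pointwise Euclidean norm at
   most 1. It is +oo exactly when E does not have finite perimeter. *)
Definition perimeter (R : realType) (E : set (plane R)) : \bar R :=
  ereal_sup [set (\int[area R]_(x in E) ('D_(1, 0) fg.1 x + 'D_(0, 1) fg.2 x)%R%:E)%E
            | fg in [set fg : (plane R -> R) * (plane R -> R) |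
                     [/\ C1_compact_support fg.1, C1_compact_support fg.2 &
                         forall x, fg.1 x ^+ 2 + fg.2 x ^+ 2 <= 1]]].

(* Restricting the infimum to Borel E is harmless: a Lebesgue measurable E
   contains a Borel set differing from it by a null set, and neither the area
   nor the perimeter sees null sets. *)
Definition cheeger (R : realType) (Omega : set (plane R)) : \bar R :=
  ereal_inf [set (perimeter E / area R E)%E
            | E in [set E : set (plane R) |
                    [/\ measurable E, E `<=` Omega & (0 < area R E)%E]]].

(* The point of parameter t on the i-th side of the closed polygonal curve with
   vertices v; vertices are indexed cyclically ([ordS]), so that side i joins
   v i to v (i + 1 mod N). *)
Definition side (R : realType) (N : nat) (v : 'I_N -> plane R) (i : 'I_N)
    (t : R) : plane R :=
  ((1 - t) * (v i).1 + t * (v (ordS i)).1,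
   (1 - t) * (v i).2 + t * (v (ordS i)).2).

Definition polygonal_curve (R : realType) (N : nat) (v : 'I_N -> plane R) :
    set (plane R) :=
  [set x | exists i t, 0 <= t <= 1 /\ x = side v i t].

(* Injectivity of the parametrization of the closed curve: the sides, each
   deprived of its endpoint, are nondegenerate and pairwise disjoint. *)
Definition simple_closed (R : realType) (N : nat) (v : 'I_N -> plane R) : Prop :=
  forall i j s t, 0 <= s < 1 -> 0 <= t < 1 ->
    side v i s = side v j t -> i = j /\ s = t.

(* No three consecutive vertices are collinear, so that the polygon has N sides
   and not fewer. *)
Definition genuine_corners (R : realType) (N : nat) (v : 'I_N -> plane R) :
    Prop :=
  forall i, let a := v i in let b := v (ordS i) in let c := v (ordS (ordS i)) in
    (b.1 - a.1) * (c.2 - b.2) - (b.2 - a.2) * (c.1 - b.1) != 0.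

(* The points off C lying in a bounded connected component of the complement of
   C; for a simple closed curve this is the Jordan interior of C. *)
Definition bounded_region (R : realType) (C : set (plane R)) : set (plane R) :=
  [set x | ~ C x /\ bounded_set (connected_component (~` C) x)].

(* N-gons are taken open, i.e., without the bounding curve. *)
Definition is_ngon (R : realType) (N : nat) (Omega : set (plane R)) : Prop :=
  exists v : 'I_N -> plane R,
    [/\ simple_closed v, genuine_corners v &
        Omega = bounded_region (polygonal_curve v)].

(* Vertices equally spaced, in cyclic order, on a circle of center c and radius
   r > 0; theta is the phase of the first vertex. *)
Definition is_regular_ngon (R : realType) (N : nat) (Omega : set (plane R)) :
    Prop :=
  exists (c : plane R) (r theta : R), 0 < r /\
    Omega = bounded_region (polygonal_curve (fun i : 'I_N =>
      (c.1 + r * cos (theta + 2 * pi * i%:R / N%:R),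
       c.2 + r * sin (theta + 2 * pi * i%:R / N%:R)))).

Definition boundary (R : realType) (A : set (plane R)) : set (plane R) :=
  closure A `\` A°.

Definition dist_to_set (R : realType) (x : plane R) (A : set (plane R)) :
    \bar R :=
  ereal_inf [set (euclid_dist x y)%:E | y in A].

Definition hausdorff_dist (R : realType) (A B : set (plane R)) : \bar R :=
  maxe (ereal_sup [set dist_to_set a B | a in A])
       (ereal_sup [set dist_to_set b A | b in B]).

(* Rigid motions are the Euclidean isometries of the plane, reflections
   included. *)
Definition rigid_motion (R : realType) (rho : plane R -> plane R) : Prop :=
  forall x y, euclid_dist (rho x) (rho y) = euclid_dist x y.

(* Main.v *)
(** The hexagon is a body of fixed size carrying a spike of length about L and
    thickness about 1/L, which has bounded area.  It contains a rectangle
    independent of L, whose ratio of perimeter to area bounds the Cheeger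
    constant.  The two tips are at distance L + 1, whereas the boundary of an
    isometric copy of the regular hexagon has bounded diameter, so that the
    Hausdorff distance grows linearly in L.

    The hexagon is the symmetric region |y| < profile x under a continuous
    piecewise affine profile; the Jordan interior of its boundary
    |y| = profile x is then identified by vertical rays, and its area is twice
    the integral of the profile. *)

Require Import Defs.
From mathcomp Require Import all_boot all_order all_algebra.
From mathcomp Require Import all_classical all_reals all_analysis.
From mathcomp Require Import measurable_realfun ring lra.

Import Order.TTheory GRing.Theory Num.Theory.
Import numFieldNormedType.Exports.

Local Open Scope classical_set_scope.
Local Open Scope ring_scope.

(** * Excluding points from the bounded region of a curve *)

(** A ray is connected, so one that avoids [C] stays in the component of its origin, which is then
    unbounded. *)
Lemma ray_unbounded {R : realType} (C : set (plane R)) (q d : plane R) :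
  d != 0 -> (forall t, 0 <= t -> ~ C (q + t *: d)) -> ~ bounded_region C q.
Proof.
move=> d0 qdC [_ [M [_ bM]]].
pose ray (t : R) : plane R := q + t *: d.
have ray0 : ray 0 = q by rewrite /ray scale0r addr0.
have ray_sub : ray @` `[0, +oo[ `<=` connected_component (~` C) q.
  apply: connected_component_max.
  - by exists 0 => //=; rewrite in_itv/= lexx.
  - move=> _ [t /= + <-]; rewrite in_itv/= andbT; exact: qdC.
  - apply: connected_continuous_connected.
      by apply/connected_intervalP; exact: interval_is_interval.
    apply: continuous_subspaceT => t.
    by apply: cvgD; [exact: cvg_cst|exact: cvgZr_tmp].
have nd0 : 0 < `|d| by rewrite normr_gt0.
pose M' := `|M| + 1.
have M'0 : 0 < M' by rewrite /M' ltr_wpDl.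
(* Chosen so that [t *: d] has norm [M' + |q| + 1]; the triangle inequality then puts [ray t]
   outside the ball of radius [M']. *)
pose t := (M' + `|q| + 1) / `|d|.
have t0 : 0 <= t by rewrite /t divr_ge0// !addr_ge0// ltW.
have rt : connected_component (~` C) q (ray t).
  by apply: ray_sub; exists t => //=; rewrite in_itv/= t0.
have := bM M' _ _ rt; rewrite /= /M' (le_lt_trans (ler_norm M)) ?ltrDl//.
move=> /(_ isT); apply/negP; rewrite -ltNge /ray -/M'.
have : `|t *: d| <= `|q + t *: d| + `|q|.
  by rewrite -{1}[t *: d](addKr q) addrC -[`|q|]normrN ler_normD.
rewrite normrZ (ger0_norm t0) /t divfK ?gt_eqF//.
rewrite -lerBlDr; apply: lt_le_trans; lra.
Qed.

(** From a point outside the box, the ray parallel to an axis along which the offending coordinate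
    is constant never meets [C]. *)
Lemma bounded_region_box {R : realType} (C : set (plane R)) (c : plane R)
    (r : R) :
  (forall x, C x -> `|x.1 - c.1| <= r /\ `|x.2 - c.2| <= r) ->
  forall x, bounded_region C x -> `|x.1 - c.1| <= r /\ `|x.2 - c.2| <= r.
Proof.
move=> Cbox x Cx; split; rewrite leNgt; apply/negP => rx; move: Cx.
- apply: (@ray_unbounded _ _ _ (0, 1)).
    by apply/eqP => -[/eqP]; rewrite oner_eq0.
  by move=> t _ /Cbox[]/=; rewrite scaler0 addr0 leNgt rx.
- apply: (@ray_unbounded _ _ _ (1, 0)).
    by apply/eqP => -[/eqP]; rewrite oner_eq0.
  by move=> t _ /Cbox[_]/=; rewrite scaler0 addr0 leNgt rx.
Qed.

Lemma open_graph_lt {R : realType} (f g : plane R -> R) :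
  continuous f -> continuous g -> open [set x | f x < g x].
Proof.
move=> cf cg; rewrite (_ : mkset _ = (g \- f) @^-1` [set y | 0 < y]).
  apply: open_comp; last exact: open_gt.
  by move=> x _; apply: cvgB; [exact: cg|exact: cf].
by apply/seteqP; split=> x /=; rewrite subr_gt0.
Qed.

(** * Jordan interior of a symmetric graph *)

Section symmetric_graph.
Context {R : realType} (phi : R -> R).
Hypothesis cphi : continuous phi.

Let abs2_cts : continuous (fun x : plane R => `|x.2|).
Proof. by move=> x; apply: cvg_norm; exact: cvg_snd. Qed.

Let phi1_cts : continuous (fun x : plane R => phi x.1).
Proof.
move=> x; apply: (@continuous_comp _ _ _ fst phi); last exact: cphi.
exact: cvg_fst.
Qed.

(* The complement of the curve is the disjoint union of two open sets, so a
   component meeting the inner one stays in it; from the outer one a vertical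
   ray escapes. *)
Lemma bounded_region_graph :
  bounded_set [set x : plane R | `|x.2| < phi x.1] ->
  bounded_region [set x | `|x.2| = phi x.1] = [set x | `|x.2| < phi x.1].
Proof.
set U := [set x : plane R | `|x.2| < phi x.1].
set C := [set x : plane R | `|x.2| = phi x.1].
pose V := [set x : plane R | phi x.1 < `|x.2|].
move=> bU; apply/seteqP; split=> x.
- move=> Cx; have [//|phix|/esym xC] := ltgtP `|x.2| (phi x.1); last first.
    by case: Cx => + _; rewrite /C/= => /(_ (esym xC)).
  exfalso; move: Cx.
  (* The ray points away from the horizontal axis: [|x.2|] does not decrease along it while
     [phi x.1] is fixed, so it cannot meet the curve. *)
  apply: (@ray_unbounded _ _ _ (0, if 0 <= x.2 then 1 else -1)).
    by apply/eqP => -[/eqP]; case: ifP => _; rewrite ?oppr_eq0 oner_eq0.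
  move=> t t0; rewrite /C/= scaler0 addr0 => phit; move: phix; rewrite -phit.
  apply/negP; rewrite -leNgt /GRing.scale/=.
  case: ifPn; rewrite -?ltNge => x2.
  + by rewrite mulr1 (ger0_norm x2) ger0_norm ?addr_ge0// lerDl.
  + rewrite mulrN1 (ltr0_norm x2) ltr0_norm ?lerN2 ?gerDl ?oppr_le0//.
    by rewrite ltr_wnDr// oppr_le0.
- move=> Ux; split; first by move=> /= Cx; move: Ux; rewrite /U/= Cx ltxx.
  have KU : connected_component (~` C) x `<=` U.
    have -> // : connected_component (~` C) x =
      connected_component (~` C) x `&` U.
    apply/esym/(@component_connected _ (~` C) x).
    - exists x; split=> //; apply: connected_component_refl.
      by move=> /= Cx; move: Ux; rewrite /U/= Cx ltxx.
    - by exists U => //; exact: open_graph_lt.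
    - exists (~` V); first exact/open_closedC/open_graph_lt.
      apply/seteqP; split=> y [Ky] /=.
      + by move=> Uy; split=> //; apply/negP; rewrite /V/= -leNgt ltW.
      + move=> /negP; rewrite -leNgt => yphi; split=> //.
        rewrite /U/= lt_neqAle yphi andbT; apply/eqP.
        exact: connected_component_sub Ky.
  have [M [Mr bM]] := bU; exists M; split=> // N MN y Ky.
  exact: bM (KU _ Ky).
Qed.
End symmetric_graph.

(** * One-dimensional integrals and area under a profile *)

Section lebesgue_line.
Context {R : realType}.
Notation mu := (@lebesgue_measure R).

Lemma FTC2_continuous (f F : R -> R) (a b : R) : a < b -> continuous f ->
  (forall x : R, is_derive x 1 F (f x)) ->
  (\int[mu]_(x in `[a, b]) (f x)%:E = (F b - F a)%:E)%E.
Proof.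
move=> ab cf dF; rewrite EFinB; apply: continuous_FTC2 => //.
- exact: continuous_subspaceT.
- have cF : continuous F.
    move=> x; apply: differentiable_continuous; apply/derivable1_diffP.
    by have [] := dF x.
  split=> [x _| |]; first by have [] := dF x.
  + by apply: cvg_at_right_filter; exact: cF.
  + by apply: cvg_at_left_filter; exact: cF.
- by move=> x _; rewrite derive1E; have [] := dF x.
Qed.

Lemma integral_affine (a b p q : R) : a < b ->
  (\int[mu]_(x in `[a, b]) (p + q * x)%:E =
   (p * (b - a) + q * (b ^+ 2 - a ^+ 2) / 2)%:E)%E.
Proof.
move=> ab; pose F x : R := p * x + q / 2 * x ^+ 2.
have dF (x : R) : is_derive x 1 F (p + q * x).
  rewrite /F; apply: is_derive_eq; rewrite /GRing.scale/=. by field.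
rewrite (@FTC2_continuous (fun x => p + q * x) F)//.
- by congr (_%:E); rewrite /F; lra.
- move=> x; apply: cvgD; first exact: cvg_cst.
  by apply: cvgM; [exact: cvg_cst|exact: cvg_id].
Qed.

Lemma integral_segment_split (f : R -> R) (a b c : R) : continuous f ->
  (forall x, 0 <= f x) -> a <= b <= c ->
  (\int[mu]_(x in `[a, c]) (f x)%:E =
   \int[mu]_(x in `[a, b]) (f x)%:E + \int[mu]_(x in `[b, c]) (f x)%:E)%E.
Proof.
move=> cf f0 /andP[ab bc].
have mf (D : set R) : measurable_fun D (fun x : R => (f x)%:E).
  apply: (measurable_funS measurableT (@subsetT _ D)).
  by apply/measurable_EFinP; exact: continuous_measurable_fun.
(* Dropping the null endpoint [b] from the first piece makes the two pieces disjoint. *)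
rewrite -(@integral_itv_bndo_bndc _ (BLeft a) b _ (mf _)).
rewrite (@itv_bndbnd_setU _ _ _ (BLeft b)) ?bnd_simp//.
rewrite ge0_integral_setU//.
- exact: mf.
- by move=> x _; rewrite lee_fin.
- apply/disj_setPS => x []/=; rewrite !in_itv/= => /andP[_ xb] /andP[bx _].
  by move: bx; rewrite leNgt xb.
Qed.

(** The section over [x] is an open interval of length [2 * phi x] if [phi x] is positive, and is
    empty otherwise; the product measure integrates these lengths. *)
Lemma area_symmetric_graph (phi : R -> R) (a b : R) : 
  (forall x, ~~ (a <= x <= b) -> phi x <= 0) ->
  area R [set x | `|x.2| < phi x.1] =
  (\int[mu]_(x in `[a, b]) (2 * Num.max 0 (phi x))%:E)%E.
Proof.
move=> phi0; rewrite [RHS]integral_mkcond.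
rewrite /area /= /product_measure1; apply: eq_integral => x _ /=.
have -> : xsection [set x | `|x.2| < phi x.1] x = `]- phi x, phi x[%classic.
  by apply/seteqP; split=> y; rewrite /xsection/= inE/= in_itv/= ltr_norml.
rewrite lebesgue_measure_itv/= lte_fin patchE.
case: ifPn => [phix|]; last first.
  rewrite -leNgt => phix; case: ifP => // _.
  by rewrite max_l ?mulr0//; lra.
rewrite ifT; last first.
  by rewrite inE/= in_itv/=; apply/negPn/negP => /phi0; lra.
rewrite max_r; last lra.
by rewrite -EFinD; congr (_%:E); lra.
Qed.

End lebesgue_line.

(** * Measurability, Fubini and perimeter for rectangles *)

Section rectangle.
Context {R : realType}.
Notation mu := (@lebesgue_measure R).
Notation mR := (measurableTypeR R).

(** Links the topology of the plane to the product sigma-algebra: an open set is the union of the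
    countably many rational squares that it contains. *)
Lemma open_measurable_plane (A : set (mR * mR)) :
  open (A : set (plane R)) -> measurable A.
Proof.
move=> oA.
pose B (p : rat * rat * rat) : set (mR * mR) :=
  ball (ratr p.1.1 : R) (ratr p.2) `*` ball (ratr p.1.2 : R) (ratr p.2).
have mB p : measurable (B p).
  by apply: measurableX; exact: measurable_ball.
suff -> : A = \bigcup_p (if `[< B p `<=` A >] then B p else set0).
  by apply: countable_bigcupT_measurable => // p; case: ifP.
apply/seteqP; split=> [[x y] Axy|z [p _]]; last first.
  by case: asboolP => // BA; exact: BA.
have [e /= e0 eA] : exists2 e : R, 0 < e & ball ((x, y) : plane R) e `<=` A.
  by move/open_nbhs_nbhs : (conj oA Axy) => /nbhs_ballP[e]; exists e.
(* With radius below [e / 2], a square whose rational center is within [r] of the point lies in the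
   ball of radius [e]. *)
have [r r0 re] : exists2 r : rat, 0 < (ratr r : R) & (ratr r : R) < e / 2.
  have : 0 < e / 2 by rewrite divr_gt0.
  by move=> /rat_in_itvoo[r]; rewrite in_itv/= => /andP[]; exists r.
have near_rat (u : R) : exists q : rat, `|u - ratr q| < ratr r.
  have : u - ratr r < u + ratr r by lra.
  move=> /rat_in_itvoo[q]; rewrite in_itv/= => q_; exists q.
  by rewrite distrC ltr_distl.
have [p xp] := near_rat x; have [q yq] := near_rat y.
exists (p, q, r) => //; rewrite ifT.
  by split; rewrite /= /ball/= distrC.
apply/asboolP => -[u v] [/=]; rewrite /ball/= => up vq.
have tri (a b c : R) : `|a - b| < ratr r -> `|b - c| < ratr r -> `|a - c| < e.
  move=> ab bc; rewrite -(subrK b a) -addrA (le_lt_trans (ler_normD _ _))//.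
  lra.
apply: eA; split; rewrite /ball/=.
- exact: tri xp up.
- exact: tri yq vq.
Qed.

Lemma continuous_measurable_plane (f : plane R -> R) (D : set (mR * mR)) :
  continuous f -> measurable_fun D (f : mR * mR -> R).
Proof.
move=> cf; apply: (measurable_funS measurableT (@subsetT _ D)).
apply: (measurability _ (RGenOpens.measurableE R)) => _ [_ [a [b ->] <-]].
rewrite setTI; apply: open_measurable_plane.
by apply: open_comp => [x _|]; [exact: cf|exact: interval_open].
Qed.

Definition rectangle (a b c d : R) : set (plane R) := `[a, b] `*` `[c, d].

Lemma measurable_rectangle (a b c d : R) :
  measurable (rectangle a b c d : set (mR * mR)).
Proof. by apply: measurableX; exact: measurable_itv. Qed.

Lemma area_rectangle (a b c d : R) : a <= b -> c <= d ->
  area R (rectangle a b c d) = ((b - a) * (d - c))%:E.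
Proof.
move=> ab cd; rewrite /area/= product_measure1E//=.
rewrite !lebesgue_measure_itv/= !lte_fin.
move: ab; rewrite le_eqVlt => /predU1P[->|->].
  by rewrite ltxx subrr mul0r mul0e.
move: cd; rewrite le_eqVlt => /predU1P[->|->].
  by rewrite ltxx subrr mulr0 mule0.
by rewrite -!EFinD -EFinM.
Qed.

(** A continuous function is bounded on a compact rectangle, which has finite area; reversed bounds
    give the empty set and are treated apart. *)
Lemma integrable_rectangle (f : plane R -> R) (a b c d : R) : continuous f ->
  (area R).-integrable (rectangle a b c d) (EFin \o f).
Proof.
move=> cf; apply: measurable_bounded_integrable.
- exact: measurable_rectangle.
- have [ab|ab] := leP a b; last first.
    by rewrite /rectangle set_itv_ge ?set0X ?measure0 ?ltry// bnd_simp -ltNge.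
  have [cd|cd] := leP c d; last first.
    rewrite /rectangle (@set_itv_ge _ _ _ (BRight d)) ?bnd_simp -?ltNge//.
    by rewrite setX0 measure0 ltry.
  by rewrite area_rectangle// ltry.
- exact: continuous_measurable_plane.
- have /compact_bounded[M [_ fM]] : compact (f @` rectangle a b c d).
    apply: continuous_compact; first exact: continuous_subspaceT.
    by apply: compact_setX; exact: segment_compact.
  exists M; split; rewrite ?num_real // => N MN x Ex.
  by apply: (fM N MN); exists x.
Qed.

(** Fubini for the extension of [f] by zero. Both orders of integration are needed, since each
    partial derivative is integrated first in its own variable. *)
Lemma integral_rectangle (f : plane R -> R) (a b c d : R) : continuous f ->
  (\int[area R]_(x in rectangle a b c d) (f x)%:E =
   \int[mu]_(x in `[a, b]) \int[mu]_(y in `[c, d]) (f (x, y))%:E)%E.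
Proof.
move=> cf; rewrite integral_mkcond /area/= -integral12_prod_meas1/=.
  rewrite [RHS]integral_mkcond; apply: eq_integral => x _.
  rewrite /fubini_F [RHS]patchE; case: ifPn => xab.
  - rewrite [RHS]integral_mkcond; apply: eq_integral => y _; rewrite !patchE.
    by rewrite in_setX/= xab.
  - by rewrite integral0_eq// => y _; rewrite patchE in_setX/= (negbTE xab).
exact: (iffLR (integrable_mkcond _ (measurable_rectangle a b c d))
  (integrable_rectangle _ _ _ _ _ cf)).
Qed.

Lemma integral_rectangle_sym (f : plane R -> R) (a b c d : R) : continuous f ->
  (\int[area R]_(x in rectangle a b c d) (f x)%:E =
   \int[mu]_(y in `[c, d]) \int[mu]_(x in `[a, b]) (f (x, y))%:E)%E.
Proof.
move=> cf; rewrite integral_mkcond /area/= -integral21_prod_meas1/=.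
  rewrite [RHS]integral_mkcond; apply: eq_integral => y _.
  rewrite /fubini_G [RHS]patchE; case: ifPn => ycd.
  - rewrite [RHS]integral_mkcond; apply: eq_integral => x _; rewrite !patchE.
    by rewrite in_setX/= ycd andbT.
  - rewrite integral0_eq// => x _.
    by rewrite patchE in_setX/= (negbTE ycd) andbF.
exact: (iffLR (integrable_mkcond _ (measurable_rectangle a b c d))
  (integrable_rectangle _ _ _ _ _ cf)).
Qed.


Lemma slice1_continuous (f : plane R -> R) (y : R) :
  continuous f -> continuous (fun x => f (x, y)).
Proof.
move=> cf x.
apply: (@continuous2_cvg _ _ _ _ _ _ idfun (cst y) (fun u v => f (u, v))).
- by under eq_fun do rewrite -surjective_pairing; exact: cf.
- exact: cvg_id.
- exact: cvg_cst.
Qed.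

Lemma slice2_continuous (f : plane R -> R) (x : R) :
  continuous f -> continuous (fun y => f (x, y)).
Proof.
move=> cf y.
apply: (@continuous2_cvg _ _ _ _ _ _ (cst x) idfun (fun u v => f (u, v))).
- by under eq_fun do rewrite -surjective_pairing; exact: cf.
- exact: cvg_cst.
- exact: cvg_id.
Qed.

(** The difference quotients of the slice and of the directional derivative are the same function of
    [h]. *)
Lemma slice1_is_derive (f : plane R -> R) (x y : R) :
  derivable f (x, y) (1, 0) ->
  is_derive x 1 (fun u => f (u, y)) ('D_(1, 0) f (x, y)).
Proof.
have E : (fun h : R => h^-1 *: ((f \o shift (x, y)) (h *: (1, 0)) - f (x, y))) =
  (fun h : R => h^-1 *: (((fun u => f (u, y)) \o shift x) (h *: 1) - f (x, y))).
  apply/funext => h /=; congr (_ *: (f _ - _)).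
  by congr pair => /=; rewrite scaler0 add0r.
by move=> df; split; rewrite /derivable /derive -E.
Qed.

Lemma slice2_is_derive (f : plane R -> R) (x y : R) :
  derivable f (x, y) (0, 1) ->
  is_derive y 1 (fun u => f (x, u)) ('D_(0, 1) f (x, y)).
Proof.
have E : (fun h : R => h^-1 *: ((f \o shift (x, y)) (h *: (0, 1)) - f (x, y))) =
  (fun h : R => h^-1 *: (((fun u => f (x, u)) \o shift y) (h *: 1) - f (x, y))).
  apply/funext => h /=; congr (_ *: (f _ - _)).
  by congr pair => /=; rewrite scaler0 add0r.
by move=> df; split; rewrite /derivable /derive -E.
Qed.

(** Bounds the flux through two opposite sides of a rectangle, [u] and [v] being the values of one
    field component on them. *)
Lemma integral_increment_le (u v : R -> R) (c d : R) : c <= d ->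
  (forall y, derivable u y 1) -> (forall y, derivable v y 1) ->
  (forall y, `|u y| <= 1) -> (forall y, `|v y| <= 1) ->
  (\int[mu]_(y in `[c, d]) (u y - v y)%:E <= (2 * (d - c))%:E)%E.
Proof.
move=> cd du dv u1 v1.
have cw : continuous (u \- v).
  move=> x; apply: differentiable_continuous; apply/derivable1_diffP.
  exact: derivableB.
have mw : measurable_fun `[c, d] (fun y : R => (u y - v y)%:E).
  apply: (measurable_funS measurableT (@subsetT _ _)).
  by apply/measurable_EFinP; exact: continuous_measurable_fun cw.
apply: (@le_trans _ _ (\int[mu]_(y in `[c, d]) `|(u y - v y)%:E|)%E).
  by apply: le_trans (lee_abs _) _; exact: le_abse_integral.
apply: (@le_trans _ _ (2%:E * mu `[c, d])%E).
  apply: integral_le_bound => //.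
  apply: aeW => y _; rewrite lee_fin (le_trans (ler_normB _ _))//.
  by rewrite [leRHS](_ : 2 = 1 + 1) ?lerD.
rewrite lebesgue_measure_itv/= lte_fin EFinM.
move: cd; rewrite le_eqVlt => /predU1P[->|->]; last by rewrite EFinB.
by rewrite ltxx subrr.
Qed.

(** The divergence theorem by hand: integrating each partial derivative in its own variable leaves
    boundary values, and both components of the field are bounded by 1. *)
Lemma perimeter_rectangle_le (a b c d : R) : a < b -> c < d ->
  (perimeter (rectangle a b c d) <= (2 * (b - a) + 2 * (d - c))%:E)%E.
Proof.
move=> ab cd; apply: ge_ereal_sup.
move=> _ [[f g] [/= [df cf _ _] [dg _ cg _] fg1] <-].
have f1 x : `|f x| <= 1.
  rewrite -(ler_pXn2r (n := 2)) ?nnegrE// real_normK ?num_real// expr1n.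
  by rewrite (le_trans _ (fg1 x))// lerDl sqr_ge0.
have g1 x : `|g x| <= 1.
  rewrite -(ler_pXn2r (n := 2)) ?nnegrE// real_normK ?num_real// expr1n.
  by rewrite (le_trans _ (fg1 x))// lerDr sqr_ge0.
under eq_integral do rewrite EFinD.
rewrite integralD//=; first last.
- exact: integrable_rectangle cg.
- exact: integrable_rectangle cf.
- exact: measurable_rectangle.
(* The component [f] crosses the vertical sides, of length [d - c], hence the exchange of the two
   terms. *)
rewrite [(2 * (b - a) + _)%R]addrC EFinD leeD//.
- rewrite integral_rectangle_sym//.
  rewrite [leLHS](_ : _ = \int[mu]_(y in `[c, d]) (f (b, y) - f (a, y))%:E)%E.
    apply: integral_increment_le => // [|y|y]; first exact: ltW.
    + by have [] := slice2_is_derive _ _ _ (df (b, y)).2.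
    + by have [] := slice2_is_derive _ _ _ (df (a, y)).2.
  apply: eq_integral => y _.
  apply: (@FTC2_continuous _ (fun x => 'D_(1, 0) f (x, y))
    (fun x => f (x, y)) a b) => //.
  + exact: slice1_continuous y cf.
  + by move=> x; exact: (slice1_is_derive f x y (df (x, y)).1).
- rewrite integral_rectangle//.
  rewrite [leLHS](_ : _ = \int[mu]_(x in `[a, b]) (g (x, d) - g (x, c))%:E)%E.
    apply: integral_increment_le => // [|x|x]; first exact: ltW.
    + by have [] := slice1_is_derive _ _ _ (dg (x, d)).1.
    + by have [] := slice1_is_derive _ _ _ (dg (x, c)).1.
  apply: eq_integral => x _.
  apply: (@FTC2_continuous _ (fun y => 'D_(0, 1) g (x, y))
    (fun y => g (x, y)) c d) => //.
  + exact: slice2_continuous x cg.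
  + by move=> y; exact: (slice2_is_derive g x y (dg (x, y)).2).
Qed.

End rectangle.

(** * Hausdorff distance and copies of the regular polygon *)

Section hausdorff.
Context {R : realType}.

Lemma dist1_le_euclid (x y : plane R) : `|x.1 - y.1| <= euclid_dist x y.
Proof.
by rewrite -sqrtr_sqr ler_wsqrtr// lerDl sqr_ge0.
Qed.

Lemma euclid_dist_le_box (x y : plane R) (r : R) :
  `|x.1 - y.1| <= r -> `|x.2 - y.2| <= r -> euclid_dist x y <= 2 * r.
Proof.
move=> xy1 xy2; have r0 : 0 <= r := le_trans (normr_ge0 _) xy1.
rewrite -[leRHS]ger0_norm; last by rewrite mulr_ge0.
rewrite -sqrtr_sqr ler_wsqrtr//.
rewrite -[X in X + _]real_normK ?num_real// -[X in _ + X]real_normK ?num_real//.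
have : `|x.1 - y.1| ^+ 2 <= r ^+ 2 by rewrite lerXn2r ?nnegrE.
have : `|x.2 - y.2| ^+ 2 <= r ^+ 2 by rewrite lerXn2r ?nnegrE.
rewrite exprMn => ? ?; have := sqr_ge0 r; lra.
Qed.

(** Horizontal distance bounds Euclidean distance from below, so a single point of [A] far from a
    vertical strip containing [B] suffices. *)
Lemma hausdorff_dist_ge (A B : set (plane R)) (u D : R) (a : plane R) :
  A a -> (forall y, B y -> `|y.1 - u| <= D) ->
  ((`|a.1 - u| - D)%:E <= hausdorff_dist A B)%E.
Proof.
move=> Aa BD; rewrite /hausdorff_dist le_max; apply/orP; left.
apply: le_trans (ereal_sup_ubound _); last by exists a; [exact: Aa|reflexivity].
apply: le_ereal_inf_tmp => _ [y By <-]; rewrite lee_fin.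
apply: le_trans (dist1_le_euclid a y).
rewrite lerBlDr -(subrK y.1 a.1) -addrA (le_trans (ler_normD _ _))//.
by rewrite subrK lerD2l BD.
Qed.

Lemma boundary_slab (A : set (plane R)) (u D : R) :
  (forall y, A y -> `|y.1 - u| <= D) ->
  forall y, boundary A y -> `|y.1 - u| <= D.
Proof.
move=> AD y [clA _].
pose S := [set y : plane R | `|y.1 - u| <= D].
have clS : closed S.
  rewrite (_ : S = (fun y : plane R => `|y.1 - u|) @^-1` [set t | t <= D])//.
  apply: closed_comp; last exact: closed_le.
  move=> x _; apply: cvg_norm; apply: cvgB; [exact: cvg_fst|exact: cvg_cst].
have : closure S y by apply: (closure_subset _ clA) => z /AD.
by move/closure_id : clS => <-.
Qed.

(** The image stays within [2 * r] of [rho c] because distances are preserved. The width of the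
    strip thus does not depend on [rho]. *)
Lemma rigid_motion_slab (A : set (plane R)) (c : plane R) (r : R)
    (rho : plane R -> plane R) : rigid_motion rho ->
  (forall x, A x -> `|x.1 - c.1| <= r /\ `|x.2 - c.2| <= r) ->
  forall y, boundary (rho @` A) y -> `|y.1 - (rho c).1| <= 2 * r.
Proof.
move=> rho_rigid Ac; apply: boundary_slab => _ [x Ax <-].
apply: le_trans (dist1_le_euclid _ _) _; rewrite rho_rigid.
by have [] := Ac x Ax; exact: euclid_dist_le_box.
Qed.

(** Points of a side are convex combinations of vertices, whose coordinates differ from those of the
    center by at most [r]. *)
Lemma regular_ngon_box (N : nat) (A : set (plane R)) : is_regular_ngon N A ->
  exists (c : plane R) (r : R),
    forall x, A x -> `|x.1 - c.1| <= r /\ `|x.2 - c.2| <= r.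
Proof.
move=> [c [r [theta [r0 ->]]]]; exists c, r; apply: bounded_region_box.
have segment_le (m u v t : R) : 0 <= t <= 1 -> `|u| <= 1 -> `|v| <= 1 ->
    `|(1 - t) * (m + r * u) + t * (m + r * v) - m| <= r.
  move=> /andP[t0 t1]; rewrite ![`|_| <= 1]ler_norml.
  move=> /andP[u0 u1] /andP[v0 v1].
  have -> : (1 - t) * (m + r * u) + t * (m + r * v) - m =
    r * ((1 - t) * u + t * v) by ring.
  rewrite normrM gtr0_norm// ler_piMr ?(ltW r0)// ler_norml.
  have t1' : 0 <= 1 - t by lra.
  have := ler_wpM2l t1' u0; have := ler_wpM2l t1' u1.
  have := ler_wpM2l t0 v0; have := ler_wpM2l t0 v1; lra.
move=> _ [i [t [t01 ->]]] /=; split; apply: segment_le => //.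
- exact: cos_max.
- exact: cos_max.
- exact: sin_max.
- exact: sin_max.
Qed.

End hausdorff.

(** * The spiked hexagon: profile and area *)

Section spiked_hexagon.
Context {R : realType} (L e : R).
Hypotheses (L_ge4 : 4 <= L) (Le : 2 * L * e = 1).

Ltac params_lra := move: L_ge4 Le; lra.

(** The absolute slope of the spike, which descends from [(1, e)] to [(L, 0)]. *)
Let s := e / (L - 1).

Let e_gt0 : 0 < e.
Proof.
have L0 : 0 < 2 * L by params_lra.
by rewrite -(pmulr_rgt0 _ L0) Le.
Qed.

Let e_le : e <= 1 / 8.
Proof.
have := ler_wpM2r (ltW e_gt0) L_ge4; params_lra.
Qed.

Let sL : s * (L - 1) = e.
Proof. by rewrite /s divfK// gt_eqF//; params_lra. Qed.

Let s_gt0 : 0 < s.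
Proof. by rewrite /s divr_gt0//; params_lra. Qed.

Let s_le : s <= 1 / 24.
Proof.
have L1 : 3 <= L - 1 by params_lra.
have := ler_wpM2l (ltW s_gt0) L1; rewrite sL; move: e_le; lra.
Qed.

(** The edge before abscissa 1 is steeper than the spike, so the corner at [(1, e)] is reflex. *)
Let slope_gt0 : 0 < 1 / 4 - e - s.
Proof. by move: e_le s_le; params_lra. Qed.

Ltac facts_lra := move: L_ge4 Le e_gt0 e_le sL s_gt0 s_le slope_gt0; lra.

(** The minimum produces the convex corner of the hexagon at abscissa 0, the maximum the reflex one
    at abscissa 1. Outside [[-1, L]] the value is negative. *)
Definition profile (x : R) : R :=
  Num.min ((1 + x) / 4) (Num.max (1 / 4 - (1 / 4 - e) * x) (s * (L - x))).

Lemma profile_continuous : continuous profile.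
Proof.
pose l1 x : R := (1 + x) / 4; pose l2 x : R := 1 / 4 - (1 / 4 - e) * x.
pose l3 x : R := s * (L - x).
suff [c1 c2 c3] : [/\ continuous l1, continuous l2 & continuous l3].
  exact: (min_fun_continuous c1 (max_fun_continuous c2 c3)).
split=> x.
- apply: cvgM; last exact: cvg_cst.
  by apply: cvgD; [exact: cvg_cst|exact: cvg_id].
- apply: cvgB; first exact: cvg_cst.
  by apply: cvgM; [exact: cvg_cst|exact: cvg_id].
- apply: cvgM; first exact: cvg_cst.
  by apply: cvgB; [exact: cvg_cst|exact: cvg_id].
Qed.

Lemma profile_left (x : R) : x <= 0 -> profile x = (1 + x) / 4.
Proof.
move=> x0; rewrite /profile min_l// le_max; apply/orP; left.
have e4 : 0 <= 1 / 4 - e by facts_lra.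
by have := mulr_ge0_le0 e4 x0; facts_lra.
Qed.

Lemma profile_mid (x : R) : 0 <= x <= 1 -> profile x = 1 / 4 - (1 / 4 - e) * x.
Proof.
move=> /andP[x0 x1]; rewrite /profile max_l ?min_r//.
- have e2 : 0 <= 1 / 2 - e by facts_lra.
  by have := mulr_ge0 e2 x0; facts_lra.
(* The two pieces inside the maximum agree at 1, and their difference is
   [(1 / 4 - e - s) * (1 - x)]. *)
- have x1' : 0 <= 1 - x by facts_lra.
  by have := mulr_ge0 (ltW slope_gt0) x1'; facts_lra.
Qed.

Lemma profile_right (x : R) : 1 <= x -> profile x = s * (L - x).
Proof.
move=> x1; have x1' : 0 <= x - 1 by facts_lra.
rewrite /profile max_r ?min_r//.
- have := mulr_ge0 (ltW s_gt0) x1'; facts_lra.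
- by have := mulr_ge0 (ltW slope_gt0) x1'; facts_lra.
Qed.

Lemma profile_ge0 (x : R) : 0 <= profile x -> -1 <= x <= L.
Proof.
have [x0|x0] := leP x 0; first by rewrite profile_left//; facts_lra.
have [x1|x1] := leP x 1; first by facts_lra.
by rewrite profile_right ?(ltW x1)// pmulr_rge0//; facts_lra.
Qed.

Lemma profile_le (x : R) : profile x <= 1 / 4.
Proof.
have [x0|x0] := leP x 0; first by rewrite profile_left//; facts_lra.
have [x1|x1] := leP x 1.
  rewrite profile_mid ?(ltW x0)//; have := mulr_ge0 (ltW x0) (ltW slope_gt0).
  by have := mulr_ge0 (ltW x0) (ltW s_gt0); facts_lra.
have x1' : 0 <= x - 1 by facts_lra.
rewrite profile_right ?(ltW x1)//; have := mulr_ge0 (ltW s_gt0) x1'.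
by facts_lra.
Qed.

Definition spiked_hexagon : set (plane R) := [set x | `|x.2| < profile x.1].

(** The three pieces have areas [1 / 4], [1 / 4 + e] and [(L - 1) * e], with sum [1 / 2 + L * e];
    the hypothesis [2 * L * e = 1] is this normalization. *)
Lemma area_spiked_hexagon : area R spiked_hexagon = 1%E.
Proof.
rewrite (@area_symmetric_graph _ _ (- 1) L); last first.
  by move=> x xN; rewrite leNgt; apply/negP => /ltW/profile_ge0; apply/negP.
pose f x := 2 * Num.max 0 (profile x).
have cf : continuous f.
  move=> x; apply: cvgM; first exact: cvg_cst.
  have c0 : continuous (cst 0 : R -> R) by exact: cst_continuous.
  exact: (max_fun_continuous c0 profile_continuous).
have f0 x : 0 <= f x by rewrite mulr_ge0// le_max lexx.
rewrite (@integral_segment_split _ f (- 1) 0 L)//; last by facts_lra.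
rewrite (@integral_segment_split _ f 0 1 L)//; last by facts_lra.
have -> : (\int[lebesgue_measure]_(x in `[(-1)%R, 0%R]) (f x)%:E =
    \int[lebesgue_measure]_(x in `[(-1)%R, 0%R]) (1 / 2 + 1 / 2 * x)%:E)%E.
  apply: eq_integral => x; rewrite inE/= in_itv/= => /andP[x1 x0].
  by rewrite /f profile_left// max_r; [congr (_%:E)|]; facts_lra.
have -> : (\int[lebesgue_measure]_(x in `[0%R, 1%R]) (f x)%:E =
    \int[lebesgue_measure]_(x in `[0%R, 1%R])
      (1 / 2 + (2 * e - 1 / 2) * x)%:E)%E.
  apply: eq_integral => x; rewrite inE/= in_itv/= => /andP[x0 x1].
  rewrite /f profile_mid ?x0// max_r; first by congr (_%:E); facts_lra.
  have := mulr_ge0 (ltW e_gt0) x0; facts_lra.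
have -> : (\int[lebesgue_measure]_(x in `[1%R, L]) (f x)%:E =
    \int[lebesgue_measure]_(x in `[1%R, L])
      (2 * (s * L) + (- (2 * s)) * x)%:E)%E.
  apply: eq_integral => x; rewrite inE/= in_itv/= => /andP[x1 xL].
  rewrite /f profile_right// max_r; first by congr (_%:E); facts_lra.
  by rewrite pmulr_rge0//; facts_lra.
rewrite !integral_affine//; last facts_lra.
rewrite -!EFinD; congr (_%:E).
(* Eliminating [s] through [s * (L - 1) = e] leaves an identity linear in [L * e] and [e]. *)
have -> : 2 * (s * L) * (L - 1) = 2 * L * e by rewrite -sL; ring.
have -> : - (2 * s) * (L ^+ 2 - 1 ^+ 2) / 2 = - (L * e + e).
  by rewrite -sL; field.
by facts_lra.
Qed.

(** * The spiked hexagon as a simple polygon *)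

(** Clockwise from the left tip. *)
Definition hexagon_vertex (i : 'I_6) : plane R :=
  nth (0, 0) [:: (- 1, 0); (0, 1 / 4); (1, e);
                 (L, 0); (1, - e); (0, - (1 / 4))] i.

Lemma hexagon_side (i : 'I_6) (t : R) : side hexagon_vertex i t =
  nth (0, 0) [:: (t - 1, t / 4); (t, 1 / 4 - (1 / 4 - e) * t);
    (1 + t * (L - 1), e * (1 - t)); (L - t * (L - 1), - (e * t));
    (1 - t, - (e + (1 / 4 - e) * t)); (- t, - ((1 - t) / 4))] i.
Proof.
by case: i => [[|[|[|[|[|[|//]]]]]] ?]; rewrite /side /hexagon_vertex/=;
  congr pair; field.
Qed.

Lemma hexagon_simple : simple_closed hexagon_vertex.
Proof.
move=> i j a b /andP[a0 a1] /andP[b0 b1]; rewrite !hexagon_side.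
have L1 : 0 < L - 1 by facts_lra.
have e4 : 0 < 1 / 4 - e by facts_lra.
(* Signs of the products that occur in the coordinates: with these products as atoms, each of the 36
   pairs of sides becomes a linear problem. *)
have range t : 0 <= t -> t < 1 ->
    [/\ 0 <= t * (L - 1), 0 < (1 - t) * (L - 1) & 0 <= e * t] /\
    [/\ 0 < e * (1 - t), 0 <= (1 / 4 - e) * t & 0 < (1 / 4 - e) * (1 - t)].
  move=> t0 t1; have t1' : 0 < 1 - t by lra.
  by do 2!split; rewrite ?mulr_gt0 ?mulr_ge0// ltW.
have [[? ? ?] [? ? ?]] := range _ a0 a1.
have [[? ? ?] [? ? ?]] := range _ b0 b1.
(* On the sides of the spike, equal abscissas give only this product equality. *)
have inj : a * (L - 1) = b * (L - 1) -> a = b by apply: mulIf; rewrite gt_eqF.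
move: (e_gt0) (e_le) (L_ge4) => ? ? ?.
case: i => [[|[|[|[|[|[|//]]]]]] ?];
  case: j => [[|[|[|[|[|[|//]]]]]] ?] /= -[? ?]; (try by exfalso; lra);
  (split; first exact: val_inj); (try lra); apply: inj; lra.
Qed.

Lemma hexagon_genuine : genuine_corners hexagon_vertex.
Proof.
(* Up to a factor, [p] is the cross product at the right tip; [q] is the one at the two reflex
   corners. *)
have p : 0 < e * (L - 1) by rewrite mulr_gt0//; facts_lra.
have q : 0 < (1 / 4 - e) * (L - 1) - e.
  have e4 : 1 / 8 <= 1 / 4 - e by facts_lra.
  have L3 : 3 <= L - 1 by facts_lra.
  have := ler_pM _ _ e4 L3; facts_lra.
move=> i; case: i => [[|[|[|[|[|[|//]]]]]] ?]; rewrite /hexagon_vertex/=;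
  apply/eqP => E; facts_lra.
Qed.

(** Sides 0, 1, 2 form the upper graph and sides 5, 4, 3 the lower one; conversely, the abscissa and
    the sign of the ordinate determine a side and its parameter. *)
Lemma hexagon_curve :
  polygonal_curve hexagon_vertex = [set x | `|x.2| = profile x.1].
Proof.
have L1 : 0 < L - 1 by facts_lra.
have e4 : 0 < 1 / 4 - e by facts_lra.
apply/seteqP; split=> [_ [i [t [/andP[t0 t1] ->]]]|].
  rewrite hexagon_side.
  have t1' : 0 <= 1 - t by facts_lra.
  have t01 : 0 <= t <= 1 by rewrite t0.
  have t01' : 0 <= 1 - t <= 1 by facts_lra.
  have q0 : 0 <= (1 / 4 - e) * (1 - t) by rewrite mulr_ge0// ltW.
  have q1 : 0 <= (1 / 4 - e) * t by rewrite mulr_ge0// ltW.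
  have q2 : 0 <= t * (L - 1) by rewrite mulr_ge0// ltW.
  have q3 : 0 <= (1 - t) * (L - 1) by rewrite mulr_ge0// ltW.
  have q4 : 0 <= e * t by rewrite mulr_ge0// ltW.
  have q5 : 0 <= e * (1 - t) by rewrite mulr_ge0// ltW.
  case: i => [[|[|[|[|[|[|//]]]]]] ?];
    rewrite /= ?normrN ger0_norm; try facts_lra.
  - by rewrite profile_left; facts_lra.
  - by rewrite profile_mid.
  - by rewrite profile_right -?sL; [ring|facts_lra].
  - by rewrite profile_right -?sL; [ring|facts_lra].
  - by rewrite profile_mid//; ring.
  - by rewrite profile_left; facts_lra.
move=> [x y] /= yx.
have /andP[x1 xL] : -1 <= x <= L by apply: profile_ge0; rewrite -yx.
have on_side k (k6 : (k < 6)%N) t : 0 <= t <= 1 ->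
    (x, y) = side hexagon_vertex (Ordinal k6) t ->
    polygonal_curve hexagon_vertex (x, y).
  by exists (Ordinal k6), t.
have [x0|x0] := leP x 0; [|have [x1'|x1'] := leP x 1].
- move: yx; rewrite profile_left//; case: (ger0P y) => y0 yx.
  + apply: (on_side 0 isT (1 + x)); first by lra.
    by rewrite hexagon_side/=; congr pair; lra.
  + apply: (on_side 5 isT (- x)); first by lra.
    by rewrite hexagon_side/=; congr pair; lra.
- move: yx; rewrite profile_mid ?x1' ?ltW//; case: (ger0P y) => y0 yx.
  + apply: (on_side 1 isT x); first by lra.
    by rewrite hexagon_side/=; congr pair; lra.
  + apply: (on_side 4 isT (1 - x)); first by lra.
    by rewrite hexagon_side/=; congr pair; lra.
- have L1t (u : R) : u / (L - 1) * (L - 1) = u by rewrite divfK// gt_eqF.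
  have et (u : R) : e * (u / (L - 1)) = s * u by rewrite /s; ring.
  have t_range (u : R) : 0 <= u <= L - 1 -> 0 <= u / (L - 1) <= 1.
    by move=> /andP[u0 u1]; rewrite divr_ge0 ?(ltW L1)//= ler_pdivrMr// mul1r.
  move: yx; rewrite profile_right ?ltW//; case: (ger0P y) => y0 yx.
  + apply: (on_side 2 isT ((x - 1) / (L - 1))); first by apply: t_range; lra.
    rewrite hexagon_side/= L1t; congr pair; first by lra.
    by rewrite mulrBr et; facts_lra.
  + apply: (on_side 3 isT ((L - x) / (L - 1))); first by apply: t_range; lra.
    rewrite hexagon_side/= L1t et; congr pair; first by lra.
    by lra.
Qed.

Lemma ngon_spiked_hexagon : is_ngon 6 spiked_hexagon.
Proof.
exists hexagon_vertex; split.
- exact: hexagon_simple.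
- exact: hexagon_genuine.
- rewrite hexagon_curve bounded_region_graph//; first exact: profile_continuous.
  exists L; split; rewrite ?num_real// => N LN [x y] /= yx.
  have /andP[x1 xL] : -1 <= x <= L.
    by apply: profile_ge0; rewrite (le_trans (normr_ge0 y)) ?ltW.
  have y1 : `|y| <= 1 / 4 by rewrite (le_trans (ltW yx)) ?profile_le.
  rewrite (le_trans _ (ltW LN))// prod_normE/= ge_max ler_norml.
  by apply/andP; split; [apply/andP; split|]; facts_lra.
Qed.

(** The profile is at least [1 / 8] on [[-1/2, 1/2]] whatever [L] and [e], so one rectangle fits in
    all the hexagons. *)
Lemma rectangle_spiked_hexagon :
  rectangle (- (1 / 2)) (1 / 2) (- (1 / 16)) (1 / 16) `<=` spiked_hexagon.
Proof.
move=> [x y] [/=]; rewrite !in_itv/= => /andP[x1 x2] /andP[y1 y2].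
have y16 : `|y| <= 1 / 16 by rewrite ler_norml y1. rewrite /spiked_hexagon/=.
apply: (le_lt_trans y16); have [x0|x0] := leP x 0.
  by rewrite profile_left//; lra.
rewrite profile_mid; last by lra.
have := mulr_ge0 (ltW e_gt0) (ltW x0); lra.
Qed.

(** * The two tips as boundary points *)

(** The point is not in the hexagon, the inequality being strict, but is approached along the
    axis. *)
Lemma profile_zero_boundary (p : R) : profile p = 0 ->
  (forall d, 0 < d -> exists2 x, `|x - p| < d & 0 < profile x) ->
  boundary spiked_hexagon (p, 0).
Proof.
move=> p0 near_p; split=> [B /nbhs_ballP[d /= d0 dB]|/interior_subset];
  last by rewrite /spiked_hexagon/= p0 normr0 ltxx.
have [x xp x0] := near_p d d0; exists (x, 0); split.
  by rewrite /spiked_hexagon/= normr0.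
by apply: dB; split; rewrite /ball/= ?subrr ?normr0// distrC.
Qed.

Lemma boundary_left_tip : boundary spiked_hexagon (- 1, 0).
Proof.
apply: profile_zero_boundary => [|d d0]; first by rewrite profile_left; lra.
(* The cap 1 keeps [-1 + m] in the range of the left affine piece. *)
pose m := Num.min (d / 2) 1.
have m0 : 0 < m by rewrite lt_min; apply/andP; split; lra.
have [md m1] : m <= d / 2 /\ m <= 1 by rewrite !ge_min !lexx orbT.
exists (- 1 + m); last by rewrite profile_left; lra.
by rewrite addrC addKr gtr0_norm//; lra.
Qed.

Lemma boundary_right_tip : boundary spiked_hexagon (L, 0).
Proof.
apply: profile_zero_boundary => [|d d0].
  by rewrite profile_right ?subrr ?mulr0//; facts_lra.
pose m := Num.min (d / 2) 1.
have m0 : 0 < m by rewrite lt_min; apply/andP; split; lra.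
have [md m1] : m <= d / 2 /\ m <= 1 by rewrite !ge_min !lexx orbT.
exists (L - m).
  by rewrite addrC addKr normrN gtr0_norm//; lra.
by rewrite profile_right; [rewrite mulr_gt0//; lra|facts_lra].
Qed.

End spiked_hexagon.

(** * Cheeger bound and divergence of the distances *)

Theorem mainTheorem2 (R : realType) (Omega0 : set (plane R))
    (hreg : is_regular_ngon 6 Omega0) (harea : area R Omega0 = 1%E) :
  exists Omega : nat -> set (plane R),
    [/\ forall k, (1 <= k)%N -> is_ngon 6 (Omega k) /\ area R (Omega k) = 1%E,
        (ereal_sup [set cheeger (Omega k) | k in [set k | (1 <= k)%N]] < +oo)%E &
        (fun k => ereal_inf [set hausdorff_dist (boundary (Omega k))
                                   (boundary (rho @` Omega0))
                            | rho in @rigid_motion R]) @ \oo --> +oo%E].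
Proof.
(* The shift by 4 ensures [4 <= L k] for every [k], and [e k] is forced by the unit area. *)
pose L (k : nat) : R := k%:R + 4; pose e k : R := (2 * L k)^-1.
have L4 k : 4 <= L k by rewrite /L lerDr.
have Le k : 2 * L k * e k = 1.
  by rewrite /e mulfV// gt_eqF// mulr_gt0// (lt_le_trans _ (L4 k)).
exists (fun k => spiked_hexagon (L k) (e k)); split.
- by move=> k _; split; [exact: ngon_spiked_hexagon|exact: area_spiked_hexagon].
- pose E : set (plane R) := rectangle (- (1 / 2)) (1 / 2) (- (1 / 16)) (1 / 16).
  have aE : area R E = (1 / 8)%:E.
    by rewrite area_rectangle; [congr (_%:E); field|lra|lra].
  have pE : (perimeter E <= (9 / 4)%:E)%E.
    by apply: le_trans (perimeter_rectangle_le _ _ _ _ _ _) _;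
      rewrite ?lee_fin; lra.
  (* The ratio of [9 / 4] to [1 / 8], for the common rectangle. *)
  apply: (@le_lt_trans _ _ 18%:E); last by rewrite ltry.
  apply: ge_ereal_sup => _ [k _ <-].
  apply: (@le_trans _ _ (perimeter E / area R E)%E).
    apply: ereal_inf_lbound; exists E => //; split.
    + exact: measurable_rectangle.
    + exact: rectangle_spiked_hexagon.
    + by rewrite aE lte_fin; lra.
  have -> : ((area R E)^-1 = 8%:E)%E.
    rewrite aE inver ifF; first by congr (_%:E); field.
    by apply/eqP; lra.
  apply: le_trans (lee_wpmul2r _ pE) _; first by rewrite lee_fin.
  by rewrite -EFinM lee_fin; lra.
- have [c [r Omega0_box]] := regular_ngon_box _ _ hreg.
  apply/cvgeyPge => A.
  near=> k.
  apply: le_ereal_inf_tmp => _ [rho rho_rigid <-].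
  (* This threshold on [k] involves only [A] and [r], so it serves all rigid motions at once. *)
  have far : A + 2 * r <= L k / 2.
    have : 2 * (A + 2 * r) <= k%:R by near: k; exact: nbhs_infty_ger.
    by rewrite /L; lra.
  have slab := rigid_motion_slab _ _ _ _ rho_rigid Omega0_box.
  (* The tip on the other side of [L k / 2] is at horizontal distance at least [L k / 2] from
     [rho c]. *)
  have [uk|uk] := leP (rho c).1 (L k / 2).
  + apply: le_trans (hausdorff_dist_ge _ _ _ _ _
      (boundary_right_tip _ _ (L4 k) (Le k)) slab).
    rewrite lee_fin /= ger0_norm; have := L4 k; lra.
  + apply: le_trans (hausdorff_dist_ge _ _ _ _ _
      (boundary_left_tip _ _ (L4 k) (Le k)) slab).
    rewrite lee_fin /= ler0_norm; have := L4 k; lra.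
Unshelve. all: by end_near.
Qed.
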